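(* For every set of formulas $\Gamma\cup\{A\}$ over $\Sigma_1$: $\Gamma\vdash_{LET_F^-}A$ iff $\Gamma\models^2_{LET_F^-}A$ iff $\Gamma\models_{\mathcal{M}_{LET_F^-}}A$.
   Context: Formulas are built from a denumerable set of propositional variables over $\Sigma_1=\{\land,\lor,\neg,\circ\}$. $LET_F^-$ is the natural deduction system with rules: ($\land$I) from $A,B$ infer $A\land B$; ($\land$E) from $A\land B$ infer $A$ and $B$; ($\lor$I) from $A$ (or from $B$) infer $A\lor B$; ($\lor$E) from $A\lor B$ and derivations of $C$ from $[A]$ and from $[B]$ infer $C$ (discharging); ($\neg\land$I) from $\neg A$ (or $\neg B$) infer $\neg(A\land B)$; ($\neg\land$E) from $\neg(A\land B)$ and derivations of $C$ from $[\neg A]$ and from $[\neg B]$ infer $C$; ($\neg\lor$I) from $\neg A,\neg B$ infer $\neg(A\lor B)$; ($\neg\lor$E) from $\neg(A\lor B)$ infer $\neg A$ and $\neg B$; (DN) $A$ and $\neg\neg A$ are inter-derivable; (EXP$^\circ$) from $\circ A,A,\neg A$ infer $B$; (PEM$^\circ$) from $\circ A$ infer $A\lor\neg A$. $\Gamma\vdash_{LET_F^-}A$ denotes derivability. A bivaluation for $LET_F^-$ is $\rho$ from formulas to $\{0,1\}$ with: $\rho(A\land B)=1$ iff $\rho(A)=\rho(B)=1$; $\rho(A\lor B)=1$ iff $\rho(A)=1$ or $\rho(B)=1$; $\rho(\neg\neg A)=1$ iff $\rho(A)=1$; $\rho(\neg(A\land B))=1$ iff $\rho(\neg A)=1$ or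 $\rho(\neg B)=1$; $\rho(\neg(A\lor B))=1$ iff $\rho(\neg A)=\rho(\neg B)=1$; if $\rho(\circ A)=1$ then ($\rho(\neg A)=1$ iff $\rho(A)=0$). $\Gamma\models^2_{LET_F^-}A$ iff every such $\rho$ giving 1 to all of $\Gamma$ gives 1 to $A$. With $\{0,1\}$ the two-element Boolean algebra ($\sqcap,\sqcup$), an Nmatrix is $(M,\mathrm{D},\mathcal{O})$ with $\emptyset\ne\mathrm{D}\subseteq M$, $\mathcal{O}(\#):M^n\to\wp(M)\setminus\{\emptyset\}$; a valuation is $v$ with $v(\#(A_1,\ldots,A_n))\in\mathcal{O}(\#)(v(A_1),\ldots,v(A_n))$; $\Gamma\models A$ iff every valuation sending $\Gamma$ into $\mathrm{D}$ sends $A$ into $\mathrm{D}$. $\mathcal{M}_{LET_F^-}$ has domain $B_{LET_K}=\{z\in\{0,1\}^3:z_3\le z_1\sqcup z_2,\ z_1\sqcap z_2\sqcap z_3=0\}$ (six elements), $\mathrm{D}=\{z:z_1=1\}$, and multioperations ($u$ ranging over $B_{LET_K}$): $z\tilde\land w=\{u:u_1=z_1\sqcap w_1,u_2=z_2\sqcup w_2\}$; $z\tilde\lor w=\{u:u_1=z_1\sqcup w_1,u_2=z_2\sqcap w_2\}$; $\tilde\neg z=\{u:u_1=z_2,u_2=z_1\}$; $\tilde\circ z=\{u:u_1=z_3\}$. *)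

(* Defs.v *)
From mathcomp Require Import all_boot.
From mathcomp Require Import classical_sets.

Set Implicit Arguments.
Unset Strict Implicit.
Unset Printing Implicit Defensive.

Local Open Scope classical_set_scope.

Inductive form : Type :=
| Var of nat
| And of form & form
| Or of form & form
| Neg of form
| Circ of form.

Declare Scope form_scope.
Delimit Scope form_scope with F.
Bind Scope form_scope with form.
Notation "A ∧ B" := (And A B) (at level 40, left associativity) : form_scope.
Notation "A ∨ B" := (Or A B) (at level 50, left associativity) : form_scope.
Notation "¬ A" := (Neg A) (at level 35, right associativity) : form_scope.
Notation "∘ A" := (Circ A) (at level 35, right associativity) : form_scope.
Local Open Scope form_scope.

(* [deriv G A]: there is a natural deduction derivation of A all of whose
   undischarged assumptions belong to G; a rule discharging an assumption [A]
   has a premise over the enlarged set [A |` G]. *)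
Inductive deriv (G : set form) : form -> Prop :=
| d_ax A : G A -> deriv G A
| d_andI A B : deriv G A -> deriv G B -> deriv G (A ∧ B)
| d_andE1 A B : deriv G (A ∧ B) -> deriv G A
| d_andE2 A B : deriv G (A ∧ B) -> deriv G B
| d_orI1 A B : deriv G A -> deriv G (A ∨ B)
| d_orI2 A B : deriv G B -> deriv G (A ∨ B)
| d_orE A B C : deriv G (A ∨ B) ->
    deriv (A |` G) C -> deriv (B |` G) C -> deriv G C
| d_nandI1 A B : deriv G (¬ A) -> deriv G (¬ (A ∧ B))
| d_nandI2 A B : deriv G (¬ B) -> deriv G (¬ (A ∧ B))
| d_nandE A B C : deriv G (¬ (A ∧ B)) ->
    deriv ((¬ A) |` G) C -> deriv ((¬ B) |` G) C -> deriv G C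
| d_norI A B : deriv G (¬ A) -> deriv G (¬ B) -> deriv G (¬ (A ∨ B))
| d_norE1 A B : deriv G (¬ (A ∨ B)) -> deriv G (¬ A)
| d_norE2 A B : deriv G (¬ (A ∨ B)) -> deriv G (¬ B)
| d_dnI A : deriv G A -> deriv G (¬ ¬ A)
| d_dnE A : deriv G (¬ ¬ A) -> deriv G A
| d_exp A B : deriv G (∘ A) -> deriv G A -> deriv G (¬ A) -> deriv G B
| d_pem A : deriv G (∘ A) -> deriv G (A ∨ ¬ A).

Record bivaluation (rho : form -> bool) : Prop := Bivaluation {
  biv_and : forall A B, rho (A ∧ B) <-> rho A /\ rho B;
  biv_or : forall A B, rho (A ∨ B) <-> rho A \/ rho B;
  biv_dn : forall A, rho (¬ ¬ A) <-> rho A;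
  biv_nand : forall A B, rho (¬ (A ∧ B)) <-> rho (¬ A) \/ rho (¬ B);
  biv_nor : forall A B, rho (¬ (A ∨ B)) <-> rho (¬ A) /\ rho (¬ B);
  biv_circ : forall A, rho (∘ A) -> (rho (¬ A) <-> rho A = false)
}.

Definition biv_entails (G : set form) (A : form) : Prop :=
  forall rho : form -> bool, bivaluation rho ->
    (forall B, G B -> rho B) -> rho A.

Record nmatrix : Type := Nmatrix {
  nm_dom : Type;
  nm_des : set nm_dom;
  nm_and : nm_dom -> nm_dom -> set nm_dom;
  nm_or : nm_dom -> nm_dom -> set nm_dom;
  nm_neg : nm_dom -> set nm_dom;
  nm_circ : nm_dom -> set nm_dom;
  nm_des_neq0 : nm_des !=set0;
  nm_and_neq0 : forall z w, nm_and z w !=set0;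
  nm_or_neq0 : forall z w, nm_or z w !=set0;
  nm_neg_neq0 : forall z, nm_neg z !=set0;
  nm_circ_neq0 : forall z, nm_circ z !=set0
}.

Record nm_valuation (M : nmatrix) (v : form -> nm_dom M) : Prop :=
  NmValuation {
  val_and : forall A B, nm_and (v A) (v B) (v (A ∧ B));
  val_or : forall A B, nm_or (v A) (v B) (v (A ∨ B));
  val_neg : forall A, nm_neg (v A) (v (¬ A));
  val_circ : forall A, nm_circ (v A) (v (∘ A))
}.

Definition nm_entails (M : nmatrix) (G : set form) (A : form) : Prop :=
  forall v : form -> nm_dom M, nm_valuation v ->
    (forall B, G B -> nm_des (v B)) -> nm_des (v A).

(* A triple (z_1, z_2, z_3) is [((z_1, z_2), z_3)]; the order on {0,1} is
   that of nat, through the coercion of bool into nat. *)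
Definition in_B_LETK (z : bool * bool * bool) : bool :=
  (z.2 <= z.1.1 || z.1.2)%N && ((z.1.1 && z.1.2 && z.2) == false).

Definition B_LETK : Type := {z : bool * bool * bool | in_B_LETK z}.

Definition p1 (z : B_LETK) : bool := (val z).1.1.
Definition p2 (z : B_LETK) : bool := (val z).1.2.
Definition p3 (z : B_LETK) : bool := (val z).2.

Definition mand (z w : B_LETK) : set B_LETK :=
  [set u | p1 u = (p1 z && p1 w) /\ p2 u = (p2 z || p2 w)].
Definition mor (z w : B_LETK) : set B_LETK :=
  [set u | p1 u = (p1 z || p1 w) /\ p2 u = (p2 z && p2 w)].
Definition mneg (z : B_LETK) : set B_LETK :=
  [set u | p1 u = p2 z /\ p2 u = p1 z].
Definition mcirc (z : B_LETK) : set B_LETK :=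
  [set u | p1 u = p3 z].
Definition mdes : set B_LETK := [set z | p1 z = true].

Lemma in_B_LETK_0 (a b : bool) : in_B_LETK (a, b, false).
Proof. by case: a; case: b. Qed.

Lemma mdes_neq0 : mdes !=set0.
Proof. by exists (exist in_B_LETK _ (in_B_LETK_0 true false)). Qed.

Lemma mand_neq0 z w : mand z w !=set0.
Proof. by exists (exist in_B_LETK _ (in_B_LETK_0 (p1 z && p1 w) (p2 z || p2 w))). Qed.

Lemma mor_neq0 z w : mor z w !=set0.
Proof. by exists (exist in_B_LETK _ (in_B_LETK_0 (p1 z || p1 w) (p2 z && p2 w))). Qed.

Lemma mneg_neq0 z : mneg z !=set0.
Proof. by exists (exist in_B_LETK _ (in_B_LETK_0 (p2 z) (p1 z))). Qed.

Lemma mcirc_neq0 z : mcirc z !=set0.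
Proof. by exists (exist in_B_LETK _ (in_B_LETK_0 (p3 z) false)). Qed.

Definition M_LETF_minus : nmatrix :=
  Nmatrix mdes_neq0 mand_neq0 mor_neq0 mneg_neq0 mcirc_neq0.

(* Main.v *)
(** Completeness for bivaluations is a Lindenbaum argument: if [G] does not
    derive [A], Zorn's lemma extends [G] to a set maximal among those not
    deriving [A]; such a set is deductively closed and prime, so its
    characteristic function is a bivaluation refuting [A].  The two semantics
    agree because a bivaluation [rho] and a valuation [v] determine each other
    through [v A = (rho A, rho (¬ A), rho (∘ A))]. *)
Require Import Defs.
From mathcomp Require Import all_boot.
From mathcomp Require Import boolp classical_sets.

Local Open Scope classical_set_scope.
Local Open Scope form_scope.

(** Only [d_ax] inspects the set of assumptions. [H] varies in the induction, because discharging
    rules enlarge both sets. *)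
Lemma deriv_weakening (G H : set form) (A : form) :
  G `<=` H -> deriv G A -> deriv H A.
Proof.
move=> sGH dA; elim: dA H sGH => {G A}.
- by move=> G A GA H sGH; apply/d_ax/sGH.
- by move=> G A B _ IA _ IB H sGH; apply: d_andI; [apply: IA | apply: IB].
- by move=> G A B _ IH H sGH; apply: (@d_andE1 _ A B); apply: IH.
- by move=> G A B _ IH H sGH; apply: (@d_andE2 _ A B); apply: IH.
- by move=> G A B _ IH H sGH; apply: d_orI1; apply: IH.
- by move=> G A B _ IH H sGH; apply: d_orI2; apply: IH.
- move=> G A B C _ IO _ IA _ IB H sGH.
  by apply: (@d_orE _ A B); [apply: IO | apply/IA/setUS | apply/IB/setUS].
- by move=> G A B _ IH H sGH; apply: d_nandI1; apply: IH.
- by move=> G A B _ IH H sGH; apply: d_nandI2; apply: IH.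
- move=> G A B C _ IO _ IA _ IB H sGH.
  by apply: (@d_nandE _ A B); [apply: IO | apply/IA/setUS | apply/IB/setUS].
- by move=> G A B _ IA _ IB H sGH; apply: d_norI; [apply: IA | apply: IB].
- by move=> G A B _ IH H sGH; apply: (@d_norE1 _ A B); apply: IH.
- by move=> G A B _ IH H sGH; apply: (@d_norE2 _ A B); apply: IH.
- by move=> G A _ IH H sGH; apply: d_dnI; apply: IH.
- by move=> G A _ IH H sGH; apply: d_dnE; apply: IH.
- by move=> G A B _ IC _ IA _ IN H sGH; apply: (@d_exp _ A);
    [apply: IC | apply: IA | apply: IN].
- by move=> G A _ IH H sGH; apply: d_pem; apply: IH.
Qed.

Lemma total_on_max2 {T : Type} {F : set (set T)} {X Y : set T} :
  total_on F subset -> F X -> F Y -> exists Z, [/\ F Z, X `<=` Z & Y `<=` Z].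
Proof.
move=> totF FX FY; have [sXY | sYX] := totF _ _ FX FY.
  by exists Y; split=> //; apply: subset_refl.
by exists X; split=> //; apply: subset_refl.
Qed.

(* The fixed part [K] absorbs the assumptions discharged in a derivation, so
   that the induction never changes the chain [F]. *)
Lemma deriv_chain_compact (F : set (set form)) (K : set form) (A : form) :
  total_on F subset -> F !=set0 ->
  deriv (K `|` \bigcup_(X in F) X) A -> exists2 X, F X & deriv (K `|` X) A.
Proof.
move=> totF [X0 FX0] dA; have sD := @subset_refl _ (K `|` \bigcup_(X in F) X).
(* The assumptions become a variable set [D], merely included in the union, so that the induction
   can enlarge [D] and [K] together. *)
move: {1 2}(K `|` _) dA sD => D dA; elim: dA K => {D A}.
- move=> D A DA K sD; case: (sD _ DA) => [KA | [X FX XA]].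
    (* An assumption from [K] singles out no member of the chain; nonemptiness of [F] provides
       one. *)
    by exists X0 => //; apply: d_ax; left.
  by exists X => //; apply: d_ax; right.
- move=> D A B _ IA _ IB K sD.
  have [X FX dA] := IA _ sD; have [Y FY dB] := IB _ sD.
  have [Z [FZ sX sY]] := total_on_max2 totF FX FY; exists Z => //.
  by apply: d_andI; [apply: deriv_weakening dA | apply: deriv_weakening dB];
    apply: setUS.
- by move=> D A B _ IH K /IH[X FX d]; exists X => //; apply: d_andE1 d.
- by move=> D A B _ IH K /IH[X FX d]; exists X => //; apply: d_andE2 d.
- by move=> D A B _ IH K /IH[X FX d]; exists X => //; apply: d_orI1.
- by move=> D A B _ IH K /IH[X FX d]; exists X => //; apply: d_orI2.
- move=> D A B C _ IO _ IA _ IB K sD; have [X FX dO] := IO _ sD.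
  have [|Y FY dA] := IA (A |` K); first by rewrite -setUA; apply: setUS.
  have [|Y' FY' dB] := IB (B |` K); first by rewrite -setUA; apply: setUS.
  have [Z [FZ sX sY]] := total_on_max2 totF FX FY.
  have [W [FW sZ sY']] := total_on_max2 totF FZ FY'; exists W => //.
  apply: (@d_orE _ A B); rewrite ?setUA.
  + by apply: deriv_weakening dO; apply: setUS; apply: subset_trans sZ.
  + by apply: deriv_weakening dA; apply: setUS; apply: subset_trans sZ.
  + by apply: deriv_weakening dB; apply: setUS.
- by move=> D A B _ IH K /IH[X FX d]; exists X => //; apply: d_nandI1.
- by move=> D A B _ IH K /IH[X FX d]; exists X => //; apply: d_nandI2.
- move=> D A B C _ IO _ IA _ IB K sD; have [X FX dO] := IO _ sD.
  have [|Y FY dA] := IA (¬ A |` K); first by rewrite -setUA; apply: setUS.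
  have [|Y' FY' dB] := IB (¬ B |` K); first by rewrite -setUA; apply: setUS.
  have [Z [FZ sX sY]] := total_on_max2 totF FX FY.
  have [W [FW sZ sY']] := total_on_max2 totF FZ FY'; exists W => //.
  apply: (@d_nandE _ A B); rewrite ?setUA.
  + by apply: deriv_weakening dO; apply: setUS; apply: subset_trans sZ.
  + by apply: deriv_weakening dA; apply: setUS; apply: subset_trans sZ.
  + by apply: deriv_weakening dB; apply: setUS.
- move=> D A B _ IA _ IB K sD.
  have [X FX dA] := IA _ sD; have [Y FY dB] := IB _ sD.
  have [Z [FZ sX sY]] := total_on_max2 totF FX FY; exists Z => //.
  by apply: d_norI; [apply: deriv_weakening dA | apply: deriv_weakening dB];
    apply: setUS.
- by move=> D A B _ IH K /IH[X FX d]; exists X => //; apply: d_norE1 d.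
- by move=> D A B _ IH K /IH[X FX d]; exists X => //; apply: d_norE2 d.
- by move=> D A _ IH K /IH[X FX d]; exists X => //; apply: d_dnI.
- by move=> D A _ IH K /IH[X FX d]; exists X => //; apply: d_dnE.
- move=> D A B _ IC _ IA _ IN K sD; have [X FX dC] := IC _ sD.
  have [Y FY dA] := IA _ sD; have [Y' FY' dN] := IN _ sD.
  have [Z [FZ sX sY]] := total_on_max2 totF FX FY.
  have [W [FW sZ sY']] := total_on_max2 totF FZ FY'; exists W => //.
  apply: (@d_exp _ A).
  + by apply: deriv_weakening dC; apply: setUS; apply: subset_trans sZ.
  + by apply: deriv_weakening dA; apply: setUS; apply: subset_trans sZ.
  + by apply: deriv_weakening dN; apply: setUS.
- by move=> D A _ IH K /IH[X FX d]; exists X => //; apply: d_pem.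
Qed.

Lemma lindenbaum (G : set form) (A : form) : ~ deriv G A ->
  exists D, [/\ G `<=` D, ~ deriv D A &
    forall B, ~ deriv D B -> deriv (B |` D) A].
Proof.
move=> nGA.
have [F sF totF|X [nXA maxX]] := @Zorn_bigcup _ [set X | ~ deriv (G `|` X) A].
  (* The empty chain, which compactness does not cover, has the empty union, and there [nGA]
     suffices. *)
  have [-> | F0] := eqVneq F set0; first by rewrite /= bigcup_set0 setU0.
  move/deriv_chain_compact => /(_ totF) [|X FX]; first exact/set0P.
  exact: sF.
exists (G `|` X); split=> // B nB; apply: contrapT => nBA.
apply: (maxX (B |` X)); last by rewrite /= setUCA.
(* The extension is proper: if [B] were in [X], it would be derivable as an assumption. *)
split=> [C XC|sBX]; first by right.
by apply: nB; apply: d_ax; right; apply: sBX; left.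
Qed.

Lemma maximal_bivaluation (D : set form) (A : form) :
  ~ deriv D A -> (forall B, ~ deriv D B -> deriv (B |` D) A) ->
  bivaluation (fun B => `[< deriv D B >]).
Proof.
move=> nA maxD; split.
- move=> B C; split=> [/asboolP d | [/asboolP dB /asboolP dC]].
    by split; apply/asboolP; [apply: d_andE1 d | apply: d_andE2 d].
  by apply/asboolP/d_andI.
- move=> B C; split=> [/asboolP d | [] /asboolP d]; last 2 first.
  + exact/asboolP/d_orI1.
  + exact/asboolP/d_orI2.
  (* Primeness: if neither disjunct is derivable, adding either one yields [A], so eliminating the
     disjunction derives [A] from [D]. *)
  apply: contrapT => /not_orP[/negP/asboolPn/maxD dB /negP/asboolPn/maxD dC].
  exact/nA/(d_orE d).
- by move=> B; split=> /asboolP d; apply/asboolP; [apply: d_dnE | apply: d_dnI].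
- move=> B C; split=> [/asboolP d | [] /asboolP d]; last 2 first.
  + exact/asboolP/d_nandI1.
  + exact/asboolP/d_nandI2.
  apply: contrapT => /not_orP[/negP/asboolPn/maxD dB /negP/asboolPn/maxD dC].
  exact/nA/(d_nandE d).
- move=> B C; split=> [/asboolP d | [/asboolP dB /asboolP dC]].
    by split; apply/asboolP; [apply: d_norE1 d | apply: d_norE2 d].
  by apply/asboolP/d_norI.
- move=> B /asboolP dC; split=> [/asboolP dN | /asboolP nB].
    by apply/asboolP => dB; apply/nA/(d_exp A dC).
  (* If neither [B] nor [¬ B] is derivable, both cases of the excluded middle given by [∘ B] yield
     [A]. *)
  apply/asboolP; apply: contrapT => /maxD dN.
  exact: nA (d_orE (d_pem dC) (maxD _ nB) dN).
Qed.

Lemma deriv_sound (G : set form) (A : form) : deriv G A -> biv_entails G A.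
Proof.
move=> dA rho bivP; have [bA bO bN bNA bNO bC] := bivP.
(* The induction fixes [rho] but keeps the truth of the assumptions in the goal; [adjoin] restores
   it for the sets enlarged by a discharge. *)
have adjoin (D : set form) B : (forall C, D C -> rho C) -> rho B ->
    forall C, (B |` D) C -> rho C by move=> DP rB C [->|/DP].
elim: dA => {G A}.
- by move=> G A GA GP; apply: GP.
- by move=> G A B _ IA _ IB GP; apply/bA; split; [apply: IA | apply: IB].
- by move=> G A B _ IH /IH/bA[].
- by move=> G A B _ IH /IH/bA[].
- by move=> G A B _ IH /IH rA; apply/bO; left.
- by move=> G A B _ IH /IH rB; apply/bO; right.
- by move=> G A B C _ IO _ IA _ IB GP; case/bO: (IO GP) => r;
    [apply/IA/adjoin | apply/IB/adjoin].
- by move=> G A B _ IH /IH rA; apply/bNA; left.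
- by move=> G A B _ IH /IH rB; apply/bNA; right.
- by move=> G A B C _ IO _ IA _ IB GP; case/bNA: (IO GP) => r;
    [apply/IA/adjoin | apply/IB/adjoin].
- by move=> G A B _ IA _ IB GP; apply/bNO; split; [apply: IA | apply: IB].
- by move=> G A B _ IH /IH/bNO[].
- by move=> G A B _ IH /IH/bNO[].
- by move=> G A _ IH /IH rA; apply/bN.
- by move=> G A _ IH /IH/bN.
- move=> G A B _ IC _ IA _ IN GP.
  by have /(bC _ (IC GP)) := IN GP; rewrite (IA GP).
- move=> G A _ IH /IH/bC rN; apply/bO.
  by case rA: (rho A); [left | right; apply/rN].
Qed.

Lemma deriv_complete (G : set form) (A : form) : biv_entails G A -> deriv G A.
Proof.
move=> GA; apply: contrapT => /lindenbaum[D [sGD nA maxD]].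
apply/nA/asboolP/(GA _ (maximal_bivaluation D A nA maxD)) => B /sGD DB.
exact/asboolP/d_ax.
Qed.

(** The only triples with third component 1 are (1,0,1) and (0,1,1). *)
Lemma p3_p2E (z : B_LETK) : p3 z -> p2 z = ~~ p1 z.
Proof. by case: z => [[[[] []] []]]. Qed.

(** Since [p1 (v (¬ A))] is [p2 (v A)], the second components of the multioperations give the
    clauses for negated formulas. *)
Lemma bivaluation_of_valuation (v : form -> B_LETK) :
  @nm_valuation M_LETF_minus v -> bivaluation (fun A => p1 (v A)).
Proof.
case=> vA vO vN vC; split=> [A B|A B|A|A B|A B|A].
- by have [-> _] := vA A B; split=> /andP.
- by have [-> _] := vO A B; split=> /orP.
- by have [-> _] := vN (¬ A); have [_ ->] := vN A.
- have [-> _] := vN (A ∧ B); have [_ ->] := vA A B.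
  by have [-> _] := vN A; have [-> _] := vN B; split=> /orP.
- have [-> _] := vN (A ∨ B); have [_ ->] := vO A B.
  by have [-> _] := vN A; have [-> _] := vN B; split=> /andP.
- rewrite (vC A) => /p3_p2E; have [-> _] := vN A => ->.
  by split=> [/negPf|->].
Qed.

(** Both constraints are trivial when [rho (∘ A)] is 0; otherwise [biv_circ] makes exactly one of
    [A] and [¬ A] true. *)
Lemma bivaluation_in_B_LETK (rho : form -> bool) (A : form) :
  bivaluation rho -> in_B_LETK (rho A, rho (¬ A), rho (∘ A)).
Proof.
move=> /biv_circ/(_ A); rewrite /in_B_LETK /=.
case: (rho (∘ A)) => [/(_ isT)[NF FN]|_]; last by case: (rho A); case: (rho (¬ A)).
case: (rho A) NF FN; case: (rho (¬ A)) => //; first by move/(_ isT).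
by move=> _ /(_ erefl).
Qed.

Definition triple_of_bivaluation (rho : form -> bool) (bivP : bivaluation rho)
    (A : form) : B_LETK :=
  exist in_B_LETK _ (bivaluation_in_B_LETK rho A bivP).

Lemma valuation_of_bivaluation (rho : form -> bool) (bivP : bivaluation rho) :
  @nm_valuation M_LETF_minus (triple_of_bivaluation rho bivP).
Proof.
have [bA bO bN bNA bNO _] := bivP.
(* For [∘ A] both sides compute to [rho (∘ A)]. The other multioperations leave the third component
   free. *)
split=> [A B|A B|A|A]; last by [].
- split; rewrite /p1 /p2 /=; apply/idP/idP.
  + by move/bA/andP.
  + by move/andP/bA.
  + by move/bNA/orP.
  + by move/orP/bNA.
- split; rewrite /p1 /p2 /=; apply/idP/idP.
  + by move/bO/orP.
  + by move/orP/bO.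
  + by move/bNO/andP.
  + by move/andP/bNO.
- by split=> //; apply/idP/idP => /bN.
Qed.

Theorem theorem5p1 (G : set form) (A : form) :
  (deriv G A <-> biv_entails G A) /\
  (biv_entails G A <-> nm_entails M_LETF_minus G A).
Proof.
split; first by split=> [/deriv_sound|/deriv_complete].
(* A value is designated when its first component is 1, so designation under a valuation is truth
   under the associated bivaluation by conversion. *)
split=> GA.
  by move=> v vP; apply: (GA (fun B => p1 (v B))); apply: bivaluation_of_valuation.
by move=> rho bivP; apply: (GA _ (valuation_of_bivaluation rho bivP)).
Qed.
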